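(* For every parameter $\varepsilon$ there exists $\varepsilon'=\Theta(\varepsilon)$ such that for every bounding family $\mathcal{B}$ on $[n]^d$ and every $(\varepsilon',\rho)$-stable product distribution $\mathcal{D}$ on $[n]^d$, any tester (even adaptive and with two-sided error) for $\mathcal{P}(\mathcal{B})$ with respect to $\mathcal{D}$ with proximity parameter $\varepsilon$ requires $\Omega(\rho\,\Delta^*(\mathcal{D}))$ queries.
   Context: A bounding family is a tuple of $2d$ functions $l_1,u_1,\dots,l_d,u_d:[n-1]\to\mathbb{R}$ with $l_r(y)<u_r(y)$ for all $r,y$. $\mathcal{P}(\mathcal{B})$ is the set of $f:[n]^d\to\mathbb{R}$ with $l_r(x_r)\le f(x+\mathbf{e}_r)-f(x)\le u_r(x_r)$ for all $r\in[d]$ and $x\in[n]^d$ with $x_r<n$. $\mathrm{dist}_{\mathcal{D}}(f,g)=\Pr_{x\sim\mathcal{D}}[f(x)\ne g(x)]$, $\mathrm{dist}_{\mathcal{D}}(f,\mathcal{P})=\inf_{g\in\mathcal{P}}\mathrm{dist}_{\mathcal{D}}(f,g)$. A tester w.r.t. $\mathcal{D}$ with proximity parameter $\varepsilon$ has query access to $f$, accepts with probability $>2/3$ if $f\in\mathcal{P}$ and rejects with probability $>2/3$ if $\mathrm{dist}_{\mathcal{D}}(f,\mathcal{P})>\varepsilon$. For a BST $T$ on $[n]$, depth is the number of edges to the root; $\Delta^*(\mathcal{D}_r)$ is the minimum over BSTs $T$ on $[n]$ of $\mathbb{E}_{v\sim\mathcal{D}_r}[\mathrm{depth}_T(v)]$,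 and $\Delta^*(\mathcal{D})=\sum_r\Delta^*(\mathcal{D}_r)$ for a product distribution $\mathcal{D}=\prod_r\mathcal{D}_r$. A product distribution $\mathcal{D}$ is $(\varepsilon',\rho)$-stable if every product distribution $\mathcal{D}'$ with $\|\mathcal{D}-\mathcal{D}'\|_{TV}\le\varepsilon'$ satisfies $\Delta^*(\mathcal{D}')\ge\rho\,\Delta^*(\mathcal{D})$. *)

(* Defs.v *)
From HB Require Import structures.
From mathcomp Require Import all_boot all_order all_algebra.
From mathcomp Require Import boolp classical_sets functions reals ereal.
From mathcomp Require Import measure probability.

Set Implicit Arguments.
Unset Strict Implicit.
Unset Printing Implicit Defensive.

Import Order.TTheory GRing.Theory Num.Theory.
Local Open Scope classical_set_scope.
Local Open Scope ring_scope.

(* [n] is represented by 'I_n = {0,...,n-1} (shifted by one);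
   [n-1] by 'I_n.-1; points of [n]^d by finite functions 'I_d -> 'I_n. *)
Definition gpoint (n d : nat) := {ffun 'I_d -> 'I_n}.

Lemma succ_lt_pred (m n : nat) : (m.+1 < n)%N -> (m < n.-1)%N.
Proof. by case: n. Qed.

(* x + e_r, given that x_r < n (1-indexed), i.e. (x r).+1 < n here *)
Definition shift_pt (n d : nat) (x : gpoint n d) (r : 'I_d)
  (h : ((x r).+1 < n)%N) : gpoint n d :=
  [ffun s => if s == r then Ordinal h else x s].

Definition bounding_family (R : realType) (n d : nat)
  (l u : 'I_d -> 'I_n.-1 -> R) : Prop :=
  forall r y, l r y < u r y.

Definition in_PB (R : realType) (n d : nat) (l u : 'I_d -> 'I_n.-1 -> R)
  (f : gpoint n d -> R) : Prop :=
  forall (r : 'I_d) (x : gpoint n d) (h : ((x r).+1 < n)%N),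
    l r (Ordinal (succ_lt_pred h)) <= f (shift_pt h) - f x /\
    f (shift_pt h) - f x <= u r (Ordinal (succ_lt_pred h)).

(* distributions on [n]; a product distribution is given by its marginals *)
Definition is_dist1 (R : realType) (n : nat) (p : 'I_n -> R) : Prop :=
  (forall v, 0 <= p v) /\ \sum_(v < n) p v = 1.

Definition is_prod_dist (R : realType) (n d : nat) (D : 'I_d -> 'I_n -> R) :=
  forall r, is_dist1 (D r).

Definition pweight (R : realType) (n d : nat) (D : 'I_d -> 'I_n -> R)
  (x : gpoint n d) : R := \prod_(r < d) D r (x r).

Definition distD (R : realType) (n d : nat) (D : 'I_d -> 'I_n -> R)
  (f g : gpoint n d -> R) : R :=
  \sum_(x : gpoint n d) pweight D x * (f x != g x)%:R.

Definition dist_to (R : realType) (n d : nat) (D : 'I_d -> 'I_n -> R)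
  (f : gpoint n d -> R) (Pr : set (gpoint n d -> R)) : R :=
  inf [set distD D f g | g in Pr].

Definition tv (R : realType) (n d : nat) (D D' : 'I_d -> 'I_n -> R) : R :=
  2^-1 * \sum_(x : gpoint n d) `|pweight D x - pweight D' x|.

Inductive bst := Leaf | Node of bst & nat & bst.

Fixpoint keys (t : bst) : seq nat :=
  match t with Leaf => [::] | Node l k r => keys l ++ k :: keys r end.

Fixpoint is_bst (t : bst) : bool :=
  match t with
  | Leaf => true
  | Node l k r => [&& all (fun v => v < k)%N (keys l),
                      all (fun v => k < v)%N (keys r), is_bst l & is_bst r]
  end.

Definition bst_on (n : nat) (t : bst) : bool :=
  is_bst t && perm_eq (keys t) (iota 0 n).

Fixpoint depth (t : bst) (v : nat) : nat :=
  match t with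
  | Leaf => 0
  | Node l k r =>
      if v == k then 0 else if (v < k)%N then (depth l v).+1 else (depth r v).+1
  end.

Definition exp_depth (R : realType) (n : nat) (p : 'I_n -> R) (t : bst) : R :=
  \sum_(v < n) p v * (depth t v)%:R.

Definition delta_star1 (R : realType) (n : nat) (p : 'I_n -> R) : R :=
  inf [set exp_depth p t | t in [set t | bst_on n t]].

Definition delta_star (R : realType) (n d : nat) (D : 'I_d -> 'I_n -> R) : R :=
  \sum_(r < d) delta_star1 (D r).

Definition stable (R : realType) (n d : nat) (eps' rho : R)
  (D : 'I_d -> 'I_n -> R) : Prop :=
  forall D', is_prod_dist D' -> tv D D' <= eps' ->
    rho * delta_star D <= delta_star D'.

(* deterministic adaptive query algorithms: decision trees over real answers *)
Inductive qtree (R T : Type) : Type :=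
  | QOut of bool
  | QAsk of T & (R -> qtree R T).

Inductive depth_le (R T : Type) : nat -> qtree R T -> Prop :=
  | DOut q b : depth_le q (QOut R T b)
  | DAsk q x k : (forall a, depth_le q (k a)) -> depth_le q.+1 (QAsk x k).

Fixpoint run (R T : Type) (t : qtree R T) (f : T -> R) : bool :=
  match t with QOut b => b | QAsk x k => run (k (f x)) f end.

(* a randomized (adaptive, two-sided error) tester making at most q queries:
   the random seed w from a probability space selects a deterministic
   query tree of depth <= q. *)
Definition is_tester (R : realType) (n d : nat) (dO : measure_display)
  (Omega : measurableType dO) (P : probability Omega R)
  (alg : Omega -> qtree R (gpoint n d)) (q : nat)
  (Pr : set (gpoint n d -> R)) (D : 'I_d -> 'I_n -> R) (eps : R) : Prop :=
  [/\ forall w, depth_le q (alg w),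
      forall f, measurable [set w | run (alg w) f],
      forall f, Pr f -> ((2/3 : R)%:E < P [set w | run (alg w) f])%E &
      forall f, eps < dist_to D f Pr ->
        ((2/3 : R)%:E < P [set w | ~~ run (alg w) f])%E].

(* Main.v *)
Require Import Defs.
From HB Require Import structures.
From mathcomp Require Import all_boot all_order all_algebra.
From mathcomp Require Import boolp classical_sets functions reals ereal.
From mathcomp Require Import measure probability.
From mathcomp Require Import lebesgue_integral measurable_realfun numfun.
From mathcomp Require Import zify ring lra.

Set Implicit Arguments.
Unset Strict Implicit.
Unset Printing Implicit Defensive.

Import Order.TTheory GRing.Theory Num.Theory.
Local Open Scope ring_scope.

(** The hard functions are [sum_r sum_(t < x_r) u_r t], the steepest function of
    the property, minus a small multiple of a value that orders the leaves of a
    tree on [n]^d obtained by stacking median search trees of the marginals. The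
    usual order gives a function in the property. Swapping the two sides of all
    nodes at depth [k], for a set of coordinates, creates violations along the
    lines in these directions; a second-moment argument bounds the distance from
    the property in terms of the total mass lying deeper than [k].

    Every node of the tree carries a random offset, so a swap is visible only to
    a tester that has queried both sides of a node. As [q] points separate at
    fewer than [q] levels, a [q]-query tester detects at most [q] of the
      disjoint
    swaps.

    The number of disjoint far swaps is compared with the optimal depth by
      moving
    all mass deeper than the last far level to the roots: this changes the
    distribution by at most [eps'] and brings the optimal depth below a constant
    times the number of swaps, so that stability applies. *)

(** * Hidden offsets *)

(** The number with base-[B] digits [w 0], ..., [w (m - 1)], most significant first, so that its
    order is lexicographic. *)
Fixpoint horner_val (B : nat) (w : nat -> nat) (m : nat) : nat :=
  if m is m'.+1 then (horner_val B w m' * B + w m')%N else 0%N.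

Lemma eq_horner_val (B : nat) (w w' : nat -> nat) (m : nat) :
  (forall j, (j < m)%N -> w j = w' j) -> horner_val B w m = horner_val B w' m.
Proof.
elim: m => //= m IH ww'; rewrite ww' // IH // => j jm.
by apply: ww'; exact: ltnW.
Qed.

Lemma horner_val_ltX (B : nat) (w : nat -> nat) (m : nat) :
  (forall j, (j < m)%N -> (w j < B)%N) -> (horner_val B w m < B ^ m)%N.
Proof.
elim: m => //= m IH wB.
have := IH (fun j jm => wB j (ltnW jm)); have := wB m (leqnn _).
by rewrite expnSr; nia.
Qed.

(** The first differing digit decides: the later digits of [w] stay below [B] and cannot make up for
    a deficit of one at position [i]. *)
Lemma horner_val_lt (B : nat) (w w' : nat -> nat) (m i : nat) :
  (i < m)%N -> (forall j, (j < i)%N -> w j = w' j) -> (w i < w' i)%N ->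
  (forall j, (j < m)%N -> (w j < B)%N) ->
  (horner_val B w m < horner_val B w' m)%N.
Proof.
move=> + ww' wi; elim: m => //= m IH; rewrite ltnS leq_eqVlt.
move=> /orP[/eqP<-|im] wB; first by rewrite (eq_horner_val _ ww') ltn_add2l.
have := IH im (fun j jm => wB j (ltnW jm)); have := wB m (leqnn _).
by nia.
Qed.

Fixpoint queries (A T : Type) (t : qtree A T) (f : T -> A) : seq T :=
  match t with
  | QOut _ => [::]
  | QAsk x k => x :: queries (k (f x)) f
  end.

Lemma size_queries (A T : Type) (t : qtree A T) (q : nat) (f : T -> A) :
  depth_le q t -> (size (queries t f) <= q)%N.
Proof.
elim: t q => //= x k IH q dt; inversion dt; subst => /=.
by rewrite ltnS; apply: IH; auto.
Qed.

(** An adaptive run chooses each query from the earlier answers only, so a function giving the same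
    answers along the run of [f] is led through the same run. *)
Lemma queries_run_eq (A : Type) (T : eqType) (t : qtree A T) (f g : T -> A) :
  {in queries t f, f =1 g} -> queries t g = queries t f /\ run t g = run t f.
Proof.
elim: t => //= x k IH fg; rewrite -fg ?mem_head//.
have [|-> ->//] := IH (f x).
by move=> y yk; apply: fg; rewrite in_cons yk orbT.
Qed.

(** * Levels at which queried points separate *)

Section HiddenOffsets.
Variables (X : finType) (L : nat) (b : X -> nat -> 'I_3).

(** The node on the path of [x] at level [j], named by the digits above it. Padding with [None] puts
    all nodes into one finite type and, for levels below [L], lets the key determine its level. *)
Definition prefix_key (x : X) (j : nat) : {ffun 'I_L -> option 'I_3} :=
  [ffun i : 'I_L => if (i < j)%N then Some (b x i) else None].

Lemma prefix_keyP (x y : X) (j : nat) : (j <= L)%N ->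
  reflect (forall i, (i < j)%N -> b x i = b y i)
          (prefix_key x j == prefix_key y j).
Proof.
move=> jL; apply: (iffP eqP) => [/ffunP kxy i ij|bxy].
  by have := kxy (Ordinal (leq_trans ij jL)); rewrite !ffunE /= ij => -[].
by apply/ffunP => i; rewrite !ffunE; case: ifP => // /bxy ->.
Qed.

Lemma prefix_key_inj_len (x y : X) (i j : nat) : (i < L)%N -> (j < L)%N ->
  prefix_key x i = prefix_key y j -> i = j.
Proof.
move=> iL jL /ffunP kxy; have [lt|lt|//] := ltngtP i j.
  by have := kxy (Ordinal iL); rewrite !ffunE /= lt ltnn.
by have := kxy (Ordinal jL); rewrite !ffunE /= lt ltnn.
Qed.

Definition split_at (x y : X) (j : nat) : bool :=
  (prefix_key x j == prefix_key y j) && (b x j != b y j).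

Definition split_levels (Q : seq X) : seq nat :=
  [seq j <- iota 0 L | has (fun x => has (split_at x ^~ j) Q) Q].

Lemma mem_split_levels (Q : seq X) (x y : X) (j : nat) :
  (j < L)%N -> x \in Q -> y \in Q -> split_at x y j -> j \in split_levels Q.
Proof.
move=> jL xQ yQ xyj; rewrite mem_filter mem_iota /= add0n jL andbT.
by apply/hasP; exists x => //; apply/hasP; exists y.
Qed.

Lemma split_levelsP (Q : seq X) (j : nat) : j \in split_levels Q ->
  exists x y, [/\ (j < L)%N, x \in Q, y \in Q & split_at x y j].
Proof.
rewrite mem_filter mem_iota /= add0n => /andP[/hasP[x xQ /hasP[y yQ xyj]] jL].
by exists x, y.
Qed.

Lemma split_atC (x y : X) (j : nat) : split_at x y j = split_at y x j.
Proof. by rewrite /split_at eq_sym [X in _ && ~~ X]eq_sym. Qed.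

(* Among two levels at which [x] splits from points of [Q], the upper one
   already splits these two points from each other. *)
Lemma split_level_new (Q : seq X) (x : X) (i j : nat) :
  i \in split_levels (x :: Q) -> j \in split_levels (x :: Q) ->
  i \notin split_levels Q -> j \notin split_levels Q -> (i < j)%N -> False.
Proof.
have new k : k \in split_levels (x :: Q) -> k \notin split_levels Q ->
    (k < L)%N /\ exists2 y, y \in Q & split_at x y k.
  case/split_levelsP => y [z [kL]]; rewrite !in_cons.
  case/predU1P => [->|yQ]; case/predU1P => [->|zQ] yzk kQ; split => //.
  - by move: yzk; rewrite /split_at !eqxx.
  - by exists z.
  - by exists y => //; rewrite split_atC.
  - by rewrite (mem_split_levels kL yQ zQ yzk) in kQ.
move=> iQ jQ niQ njQ ij.
have [iL [y yQ /andP[/(prefix_keyP _ _ (ltnW iL)) kxy bxy]]] := new _ iQ niQ.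
have [jL [z zQ /andP[/(prefix_keyP _ _ (ltnW jL)) kxz _]]] := new _ jQ njQ.
move/negP: niQ; apply; apply: (@mem_split_levels _ y z) => //.
apply/andP; split; last by rewrite -kxz // eq_sym.
apply/prefix_keyP; first exact: ltnW.
by move=> k ki; rewrite -kxy // kxz // (ltn_trans ki).
Qed.

(** Adding one point to [Q] adds at most one new level, since two new levels would contradict
    [split_level_new]. *)
Lemma size_split_levels (Q : seq X) : (size (split_levels Q) <= size Q)%N.
Proof.
elim: Q => [|x Q IH].
  by rewrite /split_levels; elim: (iota _ _).
set s := split_levels (x :: Q).
have us : uniq s by apply: filter_uniq; exact: iota_uniq.
rewrite -(count_predC (mem (split_levels Q)) s) /= -addn1 leq_add //.
  apply: leq_trans IH; rewrite -size_filter; apply: uniq_leq_size;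
    first exact: filter_uniq.
  by move=> j; rewrite mem_filter => /andP[].
rewrite -size_filter.
have := filter_uniq (predC (mem (split_levels Q))) us.
have : forall j, j \in [seq j <- s | predC (mem (split_levels Q)) j] ->
    (j \in s) && (j \notin split_levels Q).
  by move=> j; rewrite mem_filter /= andbC.
case: [seq _ <- _ | _] => [//|i [//|j l]] H /= /andP[].
rewrite inE negb_or => /andP[ij _] _.
have /andP[iS iQ] := H i (mem_head _ _).
have /andP[jS jQ] : (j \in s) && (j \notin split_levels Q).
  by apply: H; rewrite !inE eqxx orbT.
exfalso; move: ij; rewrite neq_ltn => /orP[].
  exact: (@split_level_new Q x).
exact: (@split_level_new Q x).
Qed.

(** * Random offsets and the swap-absorbing shift *)

Section Offsets.
Variable M : nat.
Let offsets := {ffun {ffun 'I_L -> option 'I_3} -> 'I_M}.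

(** The side [b x j] is hidden behind the offset of the node; for a level in [S] the reflection
    [2 - b] exchanges the two sides and fixes the middle. All values lie below [M + 2], the base
    used for [offset_val]. *)
Definition offset_digit (c : offsets) (S : pred nat) (x : X) (j : nat) : nat :=
  (c (prefix_key x j) + (if S j then 2 - b x j else b x j))%N.

Definition offset_val (c : offsets) (S : pred nat) (x : X) : nat :=
  horner_val (M + 2) (offset_digit c S x) L.

Lemma offset_digit_lt (c : offsets) (S : pred nat) (x : X) (j : nat) :
  (offset_digit c S x j < M + 2)%N.
Proof.
rewrite /offset_digit; have := ltn_ord (c (prefix_key x j)).
by have := ltn_ord (b x j); case: (S j); lia.
Qed.

Lemma offset_val_ltX (c : offsets) (S : pred nat) (x : X) :
  (offset_val c S x < (M + 2) ^ L)%N.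
Proof. by apply: horner_val_ltX => j _; exact: offset_digit_lt. Qed.

Lemma offset_val_lt (c : offsets) (S : pred nat) (x y : X) (i : nat) :
  (i < L)%N -> (forall j, (j < i)%N -> b x j = b y j) ->
  (if S i then b y i < b x i else b x i < b y i)%N ->
  (offset_val c S x < offset_val c S y)%N.
Proof.
move=> iL bxy bi.
have kxy j : (j <= i)%N -> prefix_key x j = prefix_key y j.
  move=> ji; apply/eqP/prefix_keyP; first by rewrite (leq_trans ji) // ltnW.
  by move=> k kj; apply: bxy; exact: leq_trans kj ji.
apply: (@horner_val_lt _ _ _ _ i) => //.
- by move=> j ji; rewrite /offset_digit kxy ?bxy // ltnW.
- rewrite /offset_digit kxy //; move: bi.
  by have := ltn_ord (b x i); have := ltn_ord (b y i); case: (S i); lia.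
- by move=> j _; exact: offset_digit_lt.
Qed.

(** Leaves room to move any offset by 2 in either direction inside ['I_M]. *)
Definition roomy (c : offsets) : bool :=
  [forall p, (1 < c p)%N && (c p + 2 < M)%N].

(** At a swapped node visited by [Q], adding [2 * b - 2] turns the reflected digit [c + (2 - b)]
    into [c + b]. If no level of [S] splits [Q], all visitors of the node share [b], so the choice
    made by [pick] does not matter. For roomy offsets the new value is in range and [insubd] does
    not fall back on its default. *)
Definition shift_offsets (S : pred nat) (Q : seq X) (c : offsets) : offsets :=
  [ffun p =>
    if [pick u : X * 'I_L |
         [&& u.1 \in Q, S u.2 & prefix_key u.1 u.2 == p]] is Some u
    then insubd (c p) (c p + 2 * b u.1 u.2 - 2)%N else c p].

Definition unsplit_on (S : pred nat) (Q : seq X) : bool :=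
  all (fun j => ~~ S j) (split_levels Q).

Lemma unsplit_digit (S : pred nat) (Q : seq X) (x y : X) (i j : nat) :
  unsplit_on S Q -> x \in Q -> y \in Q -> (i < L)%N -> (j < L)%N -> S j ->
  prefix_key x i = prefix_key y j -> b x i = b y j.
Proof.
move=> /allP uS xQ yQ iL jL Sj kxy.
have ij := prefix_key_inj_len iL jL kxy; subst i.
apply/eqP/negPn/negP => bxy.
have /uS : j \in split_levels Q.
  by apply: (mem_split_levels jL xQ yQ); rewrite /split_at kxy eqxx.
by rewrite Sj.
Qed.

Lemma shift_offsetsE (S : pred nat) (Q : seq X) (c : offsets) p :
  roomy c -> nat_of_ord (shift_offsets S Q c p) =
    if [pick u : X * 'I_L |
         [&& u.1 \in Q, S u.2 & prefix_key u.1 u.2 == p]] is Some u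
    then (c p + 2 * b u.1 u.2 - 2)%N else c p.
Proof.
move=> /forallP/(_ p) /andP[c1 c2]; rewrite ffunE.
case: pickP => // u _; rewrite val_insubd ifT //.
by have := ltn_ord (b u.1 u.2); lia.
Qed.

Lemma offset_val_shift (S : pred nat) (Q : seq X) (c : offsets) (x : X) :
  roomy c -> unsplit_on S Q -> x \in Q ->
  offset_val (shift_offsets S Q c) S x = offset_val c pred0 x.
Proof.
move=> rc uS xQ; apply: eq_horner_val => j jL.
rewrite /offset_digit shift_offsetsE //=.
case: pickP => [[y i] /= /and3P[yQ Si /eqP kyx]|none].
  have ij := prefix_key_inj_len (ltn_ord i) jL kyx.
  have -> : b y i = b x j by apply:
    (unsplit_digit uS _ _ (ltn_ord i) jL _ kyx); rewrite -?ij.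
  rewrite -ij Si.
  move/forallP: rc => /(_ (prefix_key x i)) /andP[].
  by have := ltn_ord (b x i); lia.
have /= := none (x, Ordinal jL).
by rewrite xQ eqxx andbT /= => ->.
Qed.

(** Outside the exceptional sets [P3] and [P4], the map [h] injects [P1] into [P2]. *)
Lemma card_offsets_le (P1 P2 P3 P4 : pred offsets) (h : offsets -> offsets) :
  {in [pred c | [&& P1 c, ~~ P3 c & ~~ P4 c]] &, injective h} ->
  (forall c, P1 c -> ~~ P3 c -> ~~ P4 c -> P2 (h c)) ->
  (#|[set c | P1 c]| <=
     #|[set c | P2 c]| + #|[set c | P3 c]| + #|[set c | P4 c]|)%N.
Proof.
move=> injh hP.
set G := [set c | [&& P1 c, ~~ P3 c & ~~ P4 c]].
have GP2 : (#|G| <= #|[set c | P2 c]|)%N.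
  rewrite -(card_in_imset (f := h) (D := mem G)); last first.
    by move=> c1 c2; rewrite !inE => H1 H2; apply: injh; rewrite inE.
  apply: subset_leq_card; apply/fintype.subsetP => _ /imsetP[c + ->].
  by rewrite !inE => /and3P[]; exact: hP.
have sub : [set c | P1 c] \subset G :|: [set c | P3 c] :|: [set c | P4 c].
  apply/fintype.subsetP => c; rewrite !inE => ->.
  by case: (P3 c); case: (P4 c).
apply: leq_trans (subset_leq_card sub) _.
apply: leq_trans (leq_card_setU _ _) _; rewrite leq_add2r.
by apply: leq_trans (leq_card_setU _ _) _; rewrite leq_add2r.
Qed.

Section OneTree.
Variables (A : Type) (Phi : X -> nat -> A) (t : qtree A X).

Definition offset_fun (S : pred nat) (c : offsets) (x : X) : A :=
  Phi x (offset_val c S x).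

(* Replaces Ramsey's theorem: [shift_offsets] makes the flipped function
   answer exactly as the unflipped one along the run. *)
Lemma flip_indistinguishable (S : pred nat) :
  (#|[set c : offsets | run t (offset_fun pred0 c)]| <=
   #|[set c : offsets | run t (offset_fun S c)]|
   + #|[set c : offsets |
         has S (split_levels (queries t (offset_fun pred0 c)))]|
   + #|[set c : offsets | ~~ roomy c]|)%N.
Proof.
pose Q c := queries t (offset_fun pred0 c).
have nosplit c : ~~ has S (split_levels (Q c)) -> unsplit_on S (Q c).
  by rewrite /unsplit_on all_predC.
have main c : roomy c -> unsplit_on S (Q c) ->
    queries t (offset_fun S (shift_offsets S (Q c) c)) = Q c /\
    run t (offset_fun S (shift_offsets S (Q c) c)) =
      run t (offset_fun pred0 c).
  move=> rc uc; apply: queries_run_eq => x xQ.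
  by rewrite /offset_fun offset_val_shift.
apply: (@card_offsets_le _ _ _ _ (fun c => shift_offsets S (Q c) c)).
  move=> c1 c2; rewrite !inE.
  move=> /and3P[_ /nosplit u1 /negPn r1] /and3P[_ /nosplit u2 /negPn r2] /= e.
  (* Running [t] on the shifted offsets reproduces the query list of the original ones. Equal images
     therefore have the same list, and with it the shift can be undone. *)
  have [q1 _] := main _ r1 u1; have [q2 _] := main _ r2 u2.
  have Q12 : Q c1 = Q c2 by rewrite -q1 -q2 e.
  apply/ffunP => p; apply: val_inj => /=.
  have := congr1 (fun g : offsets => nat_of_ord (g p)) e.
  rewrite /= !shift_offsetsE // Q12.
  move/forallP: r1 => /(_ p) /andP[+ _].
  move/forallP: r2 => /(_ p) /andP[+ _].
  by case: pickP => // u _; lia.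
move=> c acc /nosplit uc /negPn rc.
by have [_ ->] := main _ rc uc.
Qed.

(** For fixed offsets each split level has a single colour, so the at most [q] split levels expose
    at most [q] of the swaps indexed by [js]. *)
Lemma flip_indistinguishable_sum (I : eqType) (col : nat -> I) (js : seq I)
    (q : nat) : uniq js -> depth_le q t ->
  (\sum_(i <- js) #|[set c : offsets | run t (offset_fun pred0 c)]| <=
   \sum_(i <- js)
     #|[set c : offsets | run t (offset_fun (fun j => col j == i) c)]|
   + (q * #|{: offsets}| + size js * #|[set c : offsets | ~~ roomy c]|))%N.
Proof.
move=> ujs dt.
pose Q c := split_levels (queries t (offset_fun pred0 c)).
have step : (\sum_(i <- js)
    #|[set c : offsets | has (fun j => col j == i) (Q c)]|
    <= q * #|{: offsets}|)%N.
  under eq_bigr do rewrite -sum1dep_card big_mkcond /=.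
  rewrite exchange_big /= mulnC -sum_nat_const.
  apply: leq_sum => c _; rewrite -big_mkcond sum1_count -size_filter.
  apply: leq_trans (size_queries (offset_fun pred0 c) dt).
  apply: leq_trans (size_split_levels _).
  rewrite -(size_map col); apply: uniq_leq_size; first by rewrite filter_uniq.
  move=> i; rewrite mem_filter => /andP[/hasP[j jQ /eqP <-] _].
  exact: map_f.
have all_i := @leq_sum _ js predT _ _
  (fun i _ => flip_indistinguishable (fun j => col j == i)).
apply: leq_trans (all_i) _; rewrite !big_split /= -addnA leq_add2l.
by rewrite leq_add // big_const_seq count_predT iter_addn addn0 mulnC.
Qed.

End OneTree.

End Offsets.

End HiddenOffsets.

(** * Median search trees *)

(* Side taken by [v] at depth [j] of its search path: 0 left, 1 at the node,
   2 right; once the path has stopped the digit is 1. *)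
Fixpoint tree_digit (t : bst) (j v : nat) : 'I_3 :=
  match t with
  | Leaf => @Ordinal 3 1 isT
  | Node l k r =>
      if v == k then @Ordinal 3 1 isT
      else match j with
           | 0%N => if (v < k)%N then @Ordinal 3 0 isT else @Ordinal 3 2 isT
           | j'.+1 => if (v < k)%N then tree_digit l j' v else tree_digit r j' v
           end
  end.

Lemma bst_node_keys (l r : bst) (k v : nat) : is_bst (Node l k r) ->
  v \in keys (Node l k r) ->
  [\/ v = k, (v < k)%N /\ v \in keys l | (k < v)%N /\ v \in keys r].
Proof.
move=> /= /and4P[/allP vl /allP vr _ _]; rewrite mem_cat in_cons.
case/or3P => [vk|/eqP ->|vk].
- by apply: Or32; split => //; exact: vl.
- exact: Or31.
- by apply: Or33; split => //; exact: vr.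
Qed.

Lemma ltn_cmpE (u k : nat) : (u < k)%N ->
  (u == k = false) * ((u < k)%N = true).
Proof. by move=> uk; rewrite (ltn_eqF uk). Qed.

Lemma gtn_cmpE (u k : nat) : (k < u)%N ->
  (u == k = false) * ((u < k)%N = false).
Proof. by move=> uk; rewrite (gtn_eqF uk) ltnNge (ltnW uk). Qed.

(** The two search paths part at the lowest common ancestor, where the order of the sides left,
    node, right is the order of the keys. *)
Lemma first_tree_digit (t : bst) (v w : nat) : is_bst t ->
  v \in keys t -> w \in keys t -> (v < w)%N ->
  exists j, [/\ (j < size (keys t))%N,
    forall i, (i < j)%N -> tree_digit t i v = tree_digit t i w &
    (tree_digit t j v < tree_digit t j w)%N].
Proof.
elim: t => // l IHl k r IHr bt vt wt vw.
have /and4P[_ _ bl br] := bt.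
have sz : size (keys (Node l k r)) = (size (keys l) + (size (keys r)).+1)%N.
  by rewrite /= size_cat.
have root : (tree_digit (Node l k r) 0 v < tree_digit (Node l k r) 0 w)%N ->
    exists j, [/\ (j < size (keys (Node l k r)))%N,
    forall i, (i < j)%N ->
      tree_digit (Node l k r) i v = tree_digit (Node l k r) i w &
    (tree_digit (Node l k r) j v < tree_digit (Node l k r) j w)%N].
  by move=> h; exists 0%N; rewrite sz addnS.
case: (bst_node_keys bt vt) => [vk|[vk vl]|[vk vr]];
  case: (bst_node_keys bt wt) => [wk|[wk wl]|[wk wr]].
- by rewrite vk wk ltnn in vw.
- by rewrite vk ltnNge (ltnW wk) in vw.
- by apply: root; rewrite /= vk eqxx !(gtn_cmpE wk).
- by apply: root; rewrite /= wk eqxx !(ltn_cmpE vk).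
- have [j [jl dj dlt]] := IHl bl vl wl vw.
  exists j.+1; rewrite sz /= !(ltn_cmpE vk) !(ltn_cmpE wk); split => //.
    by rewrite -addn1 leq_add.
  by move=> [|i] ij //; exact: dj.
- by apply: root; rewrite /= !(ltn_cmpE vk) !(gtn_cmpE wk).
- by rewrite wk ltnNge (ltnW vk) in vw.
- by have := ltn_trans (ltn_trans vw wk) vk; rewrite ltnn.
- have [j [jl dj dlt]] := IHr br vr wr vw.
  exists j.+1; rewrite sz /= !(gtn_cmpE vk) !(gtn_cmpE wk); split => //.
    by rewrite addnS ltnS (leq_trans jl) // leq_addl.
  by move=> [|i] ij //; exact: dj.
Qed.

Lemma depth_le_size (t : bst) (v : nat) : (depth t v <= size (keys t))%N.
Proof.
elim: t => //= l IHl k r IHr; rewrite size_cat /=.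
by case: ifP => // _; case: ifP => _; lia.
Qed.

(** * Balanced trees and the mass below a level *)

Section TreeMass.
Variables (R : realFieldType) (p : nat -> R).
Hypothesis p_ge0 : forall v, 0 <= p v.

Definition tree_mass (t : bst) : R := \sum_(v <- keys t) p v.

Definition deep_mass (t : bst) (j : nat) : R :=
  \sum_(v <- keys t) p v * (j <= depth t v)%:R.

Fixpoint balanced (t : bst) : Prop :=
  match t with
  | Leaf => True
  | Node l k r =>
      [/\ 2 * tree_mass l <= tree_mass t, 2 * tree_mass r <= tree_mass t,
          balanced l & balanced r]
  end.

Lemma balanced_bst_exists (lo len : nat) :
  exists t, [/\ is_bst t, keys t = iota lo len & balanced t].
Proof.
elim/ltn_ind: len lo => -[_ lo|len IH lo]; first by exists Leaf.
pose s m := \sum_(v <- iota lo m) p v.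
(* The root is the weighted median, the first key at which half of the mass is reached; at most half
   then lies on either side. *)
have exk : exists k, s len.+1 <= 2 * s k.+1.
  exists len; have : 0 <= s len.+1 by rewrite sumr_ge0.
  lra.
have [k Pk kmin] := ex_minnP exk.
have klen : (k <= len)%N.
  apply: kmin; have : 0 <= s len.+1 by rewrite sumr_ge0.
  lra.
have [l [bl kl hl]] := IH k klen lo.
have [r [br kr hr]] := IH (len - k)%N (leq_subr _ _ :
  (_ < _.+1)%N) (lo + k.+1)%N.
have kt : keys (Node l (lo + k) r) = iota lo len.+1.
  by rewrite -[in RHS](subnKC klen) -addnS iotaD /= kl kr addnS.
exists (Node l (lo + k) r); split => //.
  apply/and4P; split => //; apply/allP => v.
    by rewrite kl mem_iota => /andP[].
  by rewrite kr mem_iota addnS => /andP[].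
rewrite /= {2 4}/tree_mass kt; split => //.
  rewrite /tree_mass kl -/(s len.+1) -/(s k);
    case: k Pk kmin {klen kl kr kt IH} => [|k] Pk kmin.
    by rewrite /s big_nil mulr0 sumr_ge0.
  rewrite leNgt; apply/negP => lt; have := kmin k (ltW lt); lia.
have : s len.+1 = s k.+1 + tree_mass r.
  by rewrite /tree_mass kr /s -big_cat -iotaD addSn (subnKC klen).
by rewrite -/(s len.+1); lra.
Qed.

Lemma sum_bst_node (l r : bst) (k : nat) (F Fl Fr : nat -> R) :
  is_bst (Node l k r) ->
  (forall v, (v < k)%N -> v \in keys l -> F v = Fl v) ->
  (forall v, (k < v)%N -> v \in keys r -> F v = Fr v) ->
  \sum_(v <- keys (Node l k r)) F v =
    \sum_(v <- keys l) Fl v + F k + \sum_(v <- keys r) Fr v.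
Proof.
move=> /= /and4P[/allP vl /allP vr _ _] HFl HFr.
rewrite big_cat big_cons /= addrA; congr (_ + _ + _).
  by apply: eq_big_seq => v vk; apply: HFl => //; exact: vl.
by apply: eq_big_seq => v vk; apply: HFr => //; exact: vr.
Qed.

Lemma deep_mass_node (l r : bst) (k j : nat) : is_bst (Node l k r) ->
  deep_mass (Node l k r) j.+1 = deep_mass l j + deep_mass r j.
Proof.
move=> bt; rewrite /deep_mass.
rewrite (sum_bst_node (Fl := fun v => p v * (j <= depth l v)%:R)
  (Fr := fun v => p v * (j <= depth r v)%:R) bt).
- by rewrite /= eqxx mulr0 addr0.
- by move=> v vk _ /=; rewrite !(ltn_cmpE vk).
- by move=> v vk _ /=; rewrite !(gtn_cmpE vk).
Qed.

Lemma deep_mass0 (t : bst) : deep_mass t 0 = tree_mass t.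
Proof. by apply: eq_bigr => v _; rewrite mulr1. Qed.

(** No two points of [W] share their node at depth [j] and take different sides there. After a swap
    at depth [j], the points of a line where the function agrees with a member of the property form
    such a set. *)
Definition level_independent (t : bst) (j : nat) (W : pred nat) : Prop :=
  forall v w, v \in keys t -> w \in keys t -> W v -> W w -> (v < w)%N ->
  (forall i, (i < j)%N -> tree_digit t i v = tree_digit t i w) ->
  (tree_digit t j v < tree_digit t j w)%N -> False.

(* The three parts left subtree, root, right subtree of a node are pairwise
   conflicting; the root gets weight at most that of the two subtrees, so that
   a heavy root is not charged more than what lies below it. *)
Lemma level_weights (t : bst) (j : nat) : is_bst t -> balanced t ->
  exists w : nat -> R, [/\ forall v, 0 <= w v <= 1,
    \sum_(v <- keys t) p v * w v <= 2 * deep_mass t j.+1 &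
    forall W, level_independent t j W ->
    deep_mass t j.+1 <= 2 * \sum_(v <- keys t) p v * w v * (~~ W v)%:R].
Proof.
elim: t j => [|l IHl k r IHr] j bt ht.
  exists (fun=> 0); split; first by move=> v; rewrite lexx ler01.
    by rewrite /deep_mass /= !big_nil mulr0.
  by move=> W _; rewrite /deep_mass /= !big_nil mulr0.
have /and4P[/allP vl /allP vr bl br] := bt; have [hl hr Hl Hr] := ht.
case: j => [|j].
  rewrite deep_mass_node // !deep_mass0.
  have tE : tree_mass (Node l k r) = tree_mass l + p k + tree_mass r.
    by rewrite /tree_mass (sum_bst_node (Fl := p) (Fr := p) bt).
  rewrite tE in hl hr.
  set a := tree_mass l in hl hr *; set b := tree_mass r in hl hr *.
  have a0 : 0 <= a by apply: sumr_ge0.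
  have b0 : 0 <= b by apply: sumr_ge0.
  have pk0 := p_ge0 k.
  pose wk := if p k <= a + b then 1 else (a + b) / p k.
  have [wk0 wk1 pwk pwk2] : [/\ 0 <= wk, wk <= 1, p k * wk <= a + b &
      p k * wk = a + b \/ p k * wk = p k].
    rewrite /wk; case: (leP (p k) (a + b)) => h /=.
      by rewrite mulr1; split; auto.
    have pk : 0 < p k by lra.
    rewrite mulrCA divff ?gt_eqF // mulr1; split; auto.
      by rewrite divr_ge0 // addr_ge0.
    by rewrite ler_pdivrMr // mul1r ltW.
  exists (fun v => if v == k then wk else 1); split.
  - by move=> v; case: ifP => _; rewrite ?wk0 ?wk1 // ler01 lexx.
  - rewrite (sum_bst_node (Fl := p) (Fr := p) bt).
    + by rewrite eqxx -/(tree_mass l) -/(tree_mass r) -/a -/b; lra.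
    + by move=> v vk _; rewrite (ltn_cmpE vk) /= mulr1.
    + by move=> v vk _; rewrite (gtn_cmpE vk) /= mulr1.
  - move=> W indep.
    rewrite (sum_bst_node (Fl := fun v => p v * (~~ W v)%:R)
      (Fr := fun v => p v * (~~ W v)%:R) bt); last 2 first.
    + by move=> v vk _; rewrite (ltn_cmpE vk) /= mulr1.
    + by move=> v vk _; rewrite (gtn_cmpE vk) /= mulr1.
    rewrite eqxx.
    have out s : (forall v, v \in s -> ~~ W v) ->
        \sum_(v <- s) p v * (~~ W v)%:R = \sum_(v <- s) p v.
      by move=> sW; apply: eq_big_seq => v /sW ->; rewrite mulr1.
    have out0 s : 0 <= \sum_(v <- s) p v * (~~ W v)%:R.
      by apply: sumr_ge0 => v _; rewrite mulr_ge0.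
    have kt : k \in keys (Node l k r) by rewrite /= mem_cat mem_head orbT.
    have lt v : v \in keys l -> v \in keys (Node l k r).
      by rewrite /= mem_cat => ->.
    have rt v : v \in keys r -> v \in keys (Node l k r).
      by rewrite /= mem_cat in_cons => ->; rewrite !orbT.
    have dl v : v \in keys l -> nat_of_ord (tree_digit (Node l k r) 0 v) = 0%N.
      by move=> /vl vk /=; rewrite !(ltn_cmpE vk).
    have dr v : v \in keys r -> nat_of_ord (tree_digit (Node l k r) 0 v) = 2%N.
      by move=> /vr vk /=; rewrite !(gtn_cmpE vk).
    have dk : nat_of_ord (tree_digit (Node l k r) 0 k) = 1%N.
      by rewrite /= eqxx.
    have outl := out0 (keys l); have outr := out0 (keys r).
    (* By independence at most one of left subtree, root and right subtree meets [W]. If it is a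
       subtree, balance bounds its mass by that of the root and the other subtree together. *)
    case: (boolP (W k)) => Wk.
      rewrite !out -/(tree_mass l) -/(tree_mass r) -/a -/b; first 1 last.
      + move=> v vr'; apply/negP => Wv.
        by apply: (indep k v) => //; [exact: rt|exact: vr|rewrite dk dr].
      + move=> v vl'; apply/negP => Wv.
        by apply: (indep v k) => //; [exact: lt|exact: vl|rewrite dk dl].
      by rewrite /= mulr0; lra.
    case: (boolP (has W (keys l))) => [/hasP[v vl' Wv]|/hasPn nol].
      rewrite [X in _ + _ + X]out -/(tree_mass r) -/b;
        first by rewrite /= mulr1; lra.
      move=> w wr; apply/negP => Ww.
      apply: (indep v w) => //; [exact: lt|exact: rt| |by rewrite dl ?dr].
      exact: ltn_trans (vl _ vl') (vr _ wr).
    by rewrite out // -/(tree_mass l) -/a /= mulr1; lra.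
have [wl [wl01 wlS wlW]] := IHl j bl Hl.
have [wr [wr01 wrS wrW]] := IHr j br Hr.
exists (fun v => if v == k then 0 else if (v < k)%N then wl v else wr v).
rewrite deep_mass_node //; split.
- by move=> v; case: ifP => _; [rewrite lexx ler01|case: ifP].
- rewrite (sum_bst_node (Fl := fun v => p v * wl v)
    (Fr := fun v => p v * wr v) bt).
  + by rewrite eqxx mulr0 mulrDr addr0 lerD.
  + by move=> v vk _; rewrite !(ltn_cmpE vk).
  + by move=> v vk _; rewrite !(gtn_cmpE vk).
- move=> W indep.
  rewrite (sum_bst_node (Fl := fun v => p v * wl v * (~~ W v)%:R)
    (Fr := fun v => p v * wr v * (~~ W v)%:R) bt); last 2 first.
  + by move=> v vk _; rewrite !(ltn_cmpE vk).
  + by move=> v vk _; rewrite !(gtn_cmpE vk).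
  rewrite eqxx mulr0 mul0r addr0 mulrDr lerD //.
    apply: wlW => v w vl' wl' Wv Ww vw dvw dlt.
    have vk := vl _ vl'; have wk := vl _ wl'.
    apply: (indep v w) => //=; try by rewrite mem_cat ?vl' ?wl'.
      by move=> [|i] ij; rewrite !(ltn_cmpE vk) !(ltn_cmpE wk) //; exact: dvw.
    by rewrite !(ltn_cmpE vk) !(ltn_cmpE wk).
  apply: wrW => v w vr' wr' Wv Ww vw dvw dlt.
  have vk := vr _ vr'; have wk := vr _ wr'.
  apply: (indep v w) => //=; try by rewrite mem_cat in_cons ?vr' ?wr' !orbT.
    by move=> [|i] ij; rewrite !(gtn_cmpE vk) !(gtn_cmpE wk) //; exact: dvw.
  by rewrite !(gtn_cmpE vk) !(gtn_cmpE wk).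
Qed.

End TreeMass.

(** * Product distributions *)

Definition set_coord (n d : nat) (x : gpoint n d) (r : 'I_d) (v : 'I_n) :
    gpoint n d := [ffun s => if s == r then v else x s].

Lemma set_coordE (n d : nat) (x : gpoint n d) (r s : 'I_d) (v : 'I_n) :
  set_coord x r v s = if s == r then v else x s.
Proof. by rewrite ffunE. Qed.

Section ProductDistribution.
Variables (R : realType) (n d : nat) (D : 'I_d -> 'I_n -> R).
Hypothesis prodD : is_prod_dist D.

Lemma pweight_ge0 (x : gpoint n d) : 0 <= pweight D x.
Proof. by apply: prodr_ge0 => r _; have [] := prodD r. Qed.

Lemma sum_pweight : \sum_x pweight D x = 1.
Proof.
rewrite /pweight -(bigA_distr_bigA (fun r v => D r v)).
by apply: big1 => r _; have [] := prodD r.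
Qed.

(** Exchanging [x r] with an independent fresh value [v] is an involution preserving the joint
    weight of [x] and [v]. *)
Lemma resample_coord (r : 'I_d) (G : gpoint n d -> R) :
  \sum_x pweight D x * (\sum_v D r v * G (set_coord x r v)) =
  \sum_x pweight D x * G x.
Proof.
under eq_bigr do rewrite big_distrr /=.
rewrite pair_bigA /=.
pose h (u : gpoint n d * 'I_n) := (set_coord u.1 r u.2, u.1 r).
have hK : involutive h.
  case=> x v; congr pair; last by rewrite set_coordE eqxx.
  by apply/ffunP => s; rewrite !set_coordE; case: eqP => // ->.
rewrite (reindex h) /=; last by exists h => u _; apply: hK.
transitivity (\sum_x \sum_v pweight D x * (D r v * G x)).
  rewrite pair_bigA /=; apply: eq_bigr => -[x v] _ /=.
  have -> : set_coord (set_coord x r v) r (x r) = x.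
    by apply/ffunP => s; rewrite !set_coordE; case: eqP => // ->.
  rewrite !mulrA; congr (_ * _).
  rewrite /pweight (bigD1 r) //= [X in _ = X * _](bigD1 r) //= set_coordE eqxx.
  rewrite (eq_bigr (fun s => D s (x s))); first by ring.
  by move=> s sr; rewrite set_coordE (negbTE sr).
apply: eq_bigr => x _; rewrite -big_distrr -big_distrl /=.
by have [_ ->] := prodD r; rewrite mul1r.
Qed.

Lemma sum_pweight_coord (r : 'I_d) (g : 'I_n -> R) :
  \sum_x pweight D x * g (x r) = \sum_v D r v * g v.
Proof.
rewrite -(resample_coord r (fun x => g (x r))).
under eq_bigr do under eq_bigr do rewrite set_coordE eqxx.
by rewrite -big_distrl /= sum_pweight mul1r.
Qed.

Lemma sum_pweight_coord2 (r s : 'I_d) (f g : 'I_n -> R) : s != r ->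
  \sum_x pweight D x * (f (x r) * g (x s)) =
  (\sum_v D r v * f v) * (\sum_v D s v * g v).
Proof.
move=> sr; rewrite -(resample_coord r (fun x => f (x r) * g (x s))).
rewrite -(sum_pweight_coord s) big_distrr /=; apply: eq_bigr => x _.
rewrite [RHS]mulrCA big_distrl /=; congr (_ * _); apply: eq_bigr => v _.
by rewrite !set_coordE eqxx (negbTE sr) mulrA.
Qed.

(** With [N] the sum of the weights [w r (x r)] over [A] and [mu] the sum of the [m r], resampling
    gives E[N 1_Z] >= mu/2, and independence gives E[N^2] <= 2 mu + 4 mu^2. Cauchy-Schwarz then
    bounds the probability of [Z] by the squared first over the second. *)
Lemma second_moment_bound (A : pred 'I_d) (w : 'I_d -> 'I_n -> R)
    (m : 'I_d -> R) (Z : pred (gpoint n d)) :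
  (forall r, 0 <= m r) -> (forall r v, 0 <= w r v <= 1) ->
  (forall r, \sum_v D r v * w r v <= 2 * m r) ->
  (forall r x, A r ->
    m r <= 2 * \sum_v D r v * (w r v * (Z (set_coord x r v))%:R)) ->
  (\sum_(r | A r) m r) / (8 + 16 * \sum_(r | A r) m r) <=
    \sum_x pweight D x * (Z x)%:R.
Proof.
move=> m0 w01 wm Zw; set mu := \sum_(r | A r) m r.
have mu0 : 0 <= mu by apply: sumr_ge0.
have D0 r v : 0 <= D r v by have [] := prodD r.
pose N (x : gpoint n d) := \sum_(r | A r) w r (x r).
have NZ : mu / 2 <= \sum_x pweight D x * (N x * (Z x)%:R).
  rewrite /N; under eq_bigr do rewrite big_distrl /= big_distrr /=.
  rewrite exchange_big /= /mu big_distrl /=; apply: ler_sum => r Ar.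
  rewrite -(resample_coord r (fun x => w r (x r) * (Z x)%:R)).
  have -> : m r / 2 = \sum_x pweight D x * (m r / 2).
    by rewrite -big_distrl /= sum_pweight mul1r.
  apply: ler_sum => x _; apply: ler_wpM2l; first exact: pweight_ge0.
  under eq_bigr do rewrite /= set_coordE eqxx.
  by rewrite ler_pdivrMr // mulrC; exact: Zw.
have NN : \sum_x pweight D x * (N x * N x) <= 2 * mu + 4 * mu ^+ 2.
  have -> : \sum_x pweight D x * (N x * N x) = \sum_(r | A r) \sum_(s | A s)
      \sum_x pweight D x * (w r (x r) * w s (x s)).
    under [RHS]eq_bigr do rewrite exchange_big /=.
    rewrite exchange_big /=; apply: eq_bigr => x _.
    rewrite /N big_distrl /= big_distrr /=; apply: eq_bigr => r _.
    by rewrite big_distrr /= big_distrr.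
  have -> : 2 * mu + 4 * mu ^+ 2 = \sum_(r | A r)
      (2 * m r + \sum_(s | A s) (2 * m r) * (2 * m s)).
    rewrite big_split /= -big_distrr /= -/mu; congr (_ + _).
    under eq_bigr do rewrite -big_distrr /=.
    by rewrite -big_distrl /= -!big_distrr /= -/mu; ring.
  apply: ler_sum => r Ar; rewrite (bigD1 r) //=; apply: lerD.
    apply: le_trans (wm r); rewrite -(sum_pweight_coord r).
    apply: ler_sum => x _; apply: ler_wpM2l; first exact: pweight_ge0.
    have /andP[w0 w1] := w01 r (x r).
    by rewrite -[leRHS]mulr1 ler_wpM2l.
  rewrite [leRHS](bigD1 r) //= ler_wpDl //; first by rewrite !mulr_ge0.
  apply: ler_sum => s /andP[_ sr]; rewrite sum_pweight_coord2 //.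
  apply: ler_pM => //; apply: sumr_ge0 => v _; apply: mulr_ge0 => //.
    by have /andP[] := w01 r v.
  by have /andP[] := w01 s v.
(* Cauchy-Schwarz in linear form: 1_Z >= 2t N 1_Z - t^2 N^2 holds pointwise, and this [t], the ratio
   of the two moment bounds, is the optimal choice. *)
set t := (4 + 8 * mu)^-1.
have -> : mu / (8 + 16 * mu) =
    2 * t * (mu / 2) - t ^+ 2 * (2 * mu + 4 * mu ^+ 2).
  by rewrite /t; field; apply/andP; split; apply: lt0r_neq0; lra.
have t0 : 0 <= t by rewrite invr_ge0; lra.
apply: (@le_trans _ _ (\sum_x pweight D x *
    (2 * t * (N x * (Z x)%:R) - t ^+ 2 * (N x * N x)))).
  under eq_bigr do rewrite mulrBr mulrCA [X in _ - X]mulrCA.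
  rewrite sumrB -!big_distrr /=; apply: lerB; apply: ler_wpM2l => //.
    by rewrite mulr_ge0.
  exact: sqr_ge0.
apply: ler_sum => x _; apply: ler_wpM2l; first exact: pweight_ge0.
have : 0 <= (t * N x - 1) ^+ 2 by exact: sqr_ge0.
have : 0 <= (t * N x) ^+ 2 by exact: sqr_ge0.
by case: (Z x); rewrite /= !expr2; lra.
Qed.

End ProductDistribution.

(** * Moving mass by a coordinatewise map *)

Section Pushforward.
Variables (R : realType) (n d : nat) (D : 'I_d -> 'I_n -> R).
Hypothesis prodD : is_prod_dist D.
Variable phi : 'I_d -> 'I_n -> 'I_n.

Definition push_dist (r : 'I_d) (v : 'I_n) : R :=
  \sum_w (phi r w == v)%:R * D r w.

Lemma sum_push_dist (r : 'I_d) (g : 'I_n -> R) :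
  \sum_v push_dist r v * g v = \sum_v D r v * g (phi r v).
Proof.
under eq_bigr do rewrite big_distrl /=.
rewrite exchange_big /=; apply: eq_bigr => w _.
rewrite (bigD1 (phi r w)) //= eqxx mul1r big1 ?addr0 // => v.
by rewrite eq_sym => /negbTE ->; rewrite !mul0r.
Qed.

Lemma push_dist_prod : is_prod_dist push_dist.
Proof.
move=> r; have [D0 D1] := prodD r; split=> [v|].
  by apply: sumr_ge0 => w _; rewrite mulr_ge0.
rewrite -D1; have := sum_push_dist r (fun=> 1).
by under eq_bigr do rewrite mulr1; under [RHS]eq_bigr do rewrite mulr1.
Qed.

Let Phi (y : gpoint n d) : gpoint n d := [ffun r => phi r (y r)].

Lemma pweight_push (x : gpoint n d) :
  pweight push_dist x = \sum_y (Phi y == x)%:R * pweight D y.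
Proof.
rewrite /pweight /push_dist
  (bigA_distr_bigA (fun r w => (phi r w == x r)%:R * D r w)).
apply: eq_bigr => y _; rewrite big_split /=; congr (_ * _).
case: eqP => [<-|ne]; first by rewrite big1 // => r _; rewrite ffunE eqxx.
have [r hr] : exists r, phi r (y r) != x r.
  apply/existsP; rewrite -negb_forall; apply/negP => /forallP h.
  by apply: ne; apply/ffunP => r; rewrite ffunE; apply/eqP.
by rewrite (bigD1 r) //= (negbTE hr) mul0r.
Qed.

(** Coupling of [y] with its image: each moved point contributes at most 2 to the L1 distance, which
    the factor 1/2 cancels. *)
Lemma tv_push_le :
  tv D push_dist <= \sum_y pweight D y * (Phi y != y)%:R.
Proof.
rewrite /tv ler_pdivrMl // big_distrr /=.
apply: (@le_trans _ _ (\sum_x \sum_y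
    pweight D y * `|(y == x)%:R - (Phi y == x)%:R|)).
  apply: ler_sum => x _.
  have -> : pweight D x = \sum_y (y == x)%:R * pweight D y.
    rewrite (bigD1 x) //= eqxx mul1r big1 ?addr0 // => y /negbTE ->.
    by rewrite mul0r.
  rewrite pweight_push -sumrB; apply: le_trans (ler_norm_sum _ _ _) _.
  apply: ler_sum => y _; rewrite -mulrBl normrM mulrC.
  by rewrite ger0_norm // pweight_ge0.
rewrite exchange_big /=; apply: ler_sum => y _; rewrite -big_distrr /= mulrCA.
apply: ler_wpM2l; first exact: pweight_ge0.
have sum1 z : \sum_x (z == x :> gpoint n d)%:R = 1 :> R.
  by rewrite (bigD1 z) //= eqxx big1 ?addr0 // => x;
    rewrite eq_sym => /negbTE ->.
case: eqP => [->|_] /=.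
  by rewrite mulr0 big1 // => x _; rewrite subrr normr0.
rewrite mulr1; apply: (@le_trans _ _ (\sum_x
    ((y == x)%:R + (Phi y == x)%:R))).
  by apply: ler_sum => x _; apply: le_trans (ler_normB _ _) _;
    rewrite !normr_nat.
by rewrite big_split /= !sum1; lra.
Qed.

Lemma tv_push_le1 : tv D push_dist <= 1.
Proof.
apply: le_trans tv_push_le _.
apply: (@le_trans _ _ (\sum_y pweight D y)); last by rewrite sum_pweight.
apply: ler_sum => y _; apply: ler_piMr; first exact: pweight_ge0.
by rewrite lern1 leq_b1.
Qed.

Lemma tv_push_le_sum :
  tv D push_dist <= \sum_r \sum_v D r v * (phi r v != v)%:R.
Proof.
apply: le_trans tv_push_le _.
under [leRHS]eq_bigr do
  rewrite -(sum_pweight_coord prodD _ (fun v => (phi _ v != v)%:R)).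
rewrite exchange_big /=; apply: ler_sum => y _; rewrite -big_distrr /=.
apply: ler_wpM2l; first exact: pweight_ge0.
case: eqP => [_|ne] /=; first by rewrite sumr_ge0.
have [r hr] : exists r, phi r (y r) != y r.
  apply/existsP; rewrite -negb_forall; apply/negP => /forallP h.
  by apply: ne; apply/ffunP => r; rewrite ffunE; apply/eqP.
by rewrite (bigD1 r) //= hr ler_wpDr // sumr_ge0.
Qed.

End Pushforward.

(** * Perturbations of the maximal function *)

Section BoundingFamily.
Variables (R : realType) (n d : nat) (l u : 'I_d -> 'I_n.-1 -> R).

(** Extended by 0 past the last step, so that partial sums can run over natural numbers. *)
Definition upper_step (r : 'I_d) (t : nat) : R :=
  if insub t is Some y then u r y else 0.

Definition upper_sum (r : 'I_d) (m : nat) : R := \sum_(t < m) upper_step r t.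

Definition upper_base (x : gpoint n d) : R := \sum_r upper_sum r (x r).

Lemma upper_sumS (r : 'I_d) (m : nat) (h : (m < n.-1)%N) :
  upper_sum r m.+1 = upper_sum r m + u r (Ordinal h).
Proof.
rewrite /upper_sum big_ord_recr /=; congr (_ + _).
by rewrite /upper_step insubT.
Qed.

Lemma upper_base_set_coord (x : gpoint n d) (r : 'I_d) (v w : 'I_n) :
  upper_base (set_coord x r w) - upper_base (set_coord x r v) =
  upper_sum r w - upper_sum r v.
Proof.
rewrite /upper_base (bigD1 r) //= [X in _ - X](bigD1 r) //= !set_coordE eqxx.
rewrite (eq_bigr (fun s => upper_sum s (set_coord x r v s))).
  by rewrite opprD addrACA subrr addr0.
by move=> s sr; rewrite !set_coordE (negbTE sr).
Qed.

Lemma shift_ptE (x : gpoint n d) (r : 'I_d) (h : ((x r).+1 < n)%N) :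
  shift_pt h = set_coord x r (Ordinal h).
Proof. by []. Qed.

Lemma set_coord_id (x : gpoint n d) (r : 'I_d) : set_coord x r (x r) = x.
Proof. by apply/ffunP => s; rewrite set_coordE; case: eqP => // ->. Qed.

Lemma set_coord_twice (x : gpoint n d) (r : 'I_d) (v w : 'I_n) :
  set_coord (set_coord x r v) r w = set_coord x r w.
Proof. by apply/ffunP => s; rewrite !set_coordE; case: eqP. Qed.

Lemma in_PB_line (h : gpoint n d -> R) (x : gpoint n d) (r : 'I_d)
    (v w : 'I_n) : in_PB l u h -> (v <= w)%N ->
  h (set_coord x r w) - h (set_coord x r v) <= upper_sum r w - upper_sum r v.
Proof.
move=> hP vw; have [k wE] : exists k, nat_of_ord w = (v + k)%N.
  by exists (w - v)%N; rewrite subnKC.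
elim: k w wE {vw} => [|k IH] w wE.
  have -> : w = v by apply: val_inj; rewrite /= wE addn0.
  by rewrite !subrr.
have vkn : (v + k < n)%N by rewrite (leq_trans _ (ltn_ord w)) // wE addnS.
have := IH (Ordinal vkn) erefl.
set y := set_coord x r (Ordinal vkn).
have hy : ((y r).+1 < n)%N by rewrite set_coordE eqxx /= -addnS -wE.
have [_] := hP r y hy; rewrite shift_ptE set_coord_twice.
have -> : Ordinal hy = w.
  by apply: val_inj; rewrite /= set_coordE eqxx /= wE addnS.
move=> step low; rewrite wE addnS.
have ht : (v + k < n.-1)%N by apply: succ_lt_pred; rewrite -addnS -wE.
rewrite (upper_sumS r ht).
have yE : Ordinal (succ_lt_pred hy) = Ordinal ht.
  by apply: val_inj; rewrite /= set_coordE eqxx.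
rewrite yE in step; move: step low; rewrite /=; lra.
Qed.

Definition perturbed (delta : R) (x : gpoint n d) (m : nat) : R :=
  upper_base x - delta * m%:R.

(** A monotone [val] only lowers the steps of the steepest function, and by at most [delta * V],
    which fits into every gap between [l] and [u]. *)
Lemma perturbed_in_PB (delta : R) (V : nat) (val : gpoint n d -> nat) :
  0 < delta -> (forall r y, delta * V%:R <= u r y - l r y) ->
  (forall x, (val x < V)%N) ->
  (forall x r (v w : 'I_n), (v < w)%N ->
    (val (set_coord x r v) <= val (set_coord x r w))%N) ->
  in_PB l u (fun x => perturbed delta x (val x)).
Proof.
move=> delta0 dV valV mono r x h; rewrite shift_ptE /perturbed.
have := mono x r (x r) (Ordinal h) (leqnn _); rewrite set_coord_id => le.
have := upper_base_set_coord x r (x r) (Ordinal h); rewrite set_coord_id /=.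
rewrite (upper_sumS r (succ_lt_pred h)) => base.
set y := set_coord x r (Ordinal h) in le base *.
have lev : (val x)%:R <= (val y)%:R :> R by rewrite ler_nat.
have ltv : (val y)%:R <= V%:R :> R by rewrite ler_nat ltnW.
have v0 : 0 <= (val x)%:R :> R by [].
have e1 : 0 <= delta * ((val y)%:R - (val x)%:R) by apply: mulr_ge0;
  [exact: ltW|rewrite subr_ge0].
have e2 : delta * ((val y)%:R - (val x)%:R) <= delta * V%:R.
  by rewrite ler_pM2l //; lra.
have := dV r (Ordinal (succ_lt_pred h)).
by split; lra.
Qed.

(** If [val] drops from [v] to [w], the perturbed function rises by more than the sum of the upper
    bounds between them, so no member of the property can agree with it at both ends. *)
Lemma perturbed_violation (delta : R) (val : gpoint n d -> nat)
    (h : gpoint n d -> R) (x : gpoint n d) (r : 'I_d) (v w : 'I_n) :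
  0 < delta -> in_PB l u h -> (v < w)%N ->
  (val (set_coord x r w) < val (set_coord x r v))%N ->
  perturbed delta (set_coord x r v) (val (set_coord x r v)) =
    h (set_coord x r v) ->
  perturbed delta (set_coord x r w) (val (set_coord x r w)) =
    h (set_coord x r w) -> False.
Proof.
move=> delta0 hP vw lt ev ew; have := in_PB_line x r hP (ltnW vw).
rewrite -ev -ew /perturbed; have := upper_base_set_coord x r v w.
have : delta * (val (set_coord x r w))%:R < delta * (val (set_coord x r v))%:R.
  by rewrite ltr_pM2l // ltr_nat.
lra.
Qed.

Lemma perturbation_scale (V : nat) : bounding_family l u ->
  exists2 delta : R, 0 < delta & forall r y, delta * V%:R <= u r y - l r y.
Proof.
move=> lu; pose g r y := V%:R / (u r y - l r y).
have g0 r y : 0 <= g r y by rewrite divr_ge0 // subr_ge0 ltW.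
(* The sum serves as an upper bound for every ratio [g r y]; the summand 1 keeps it positive even
   when the sum is empty. *)
pose s := 1 + \sum_r \sum_y g r y.
have s0 : 0 < s.
  by rewrite ltr_pwDl // sumr_ge0 // => r _; rewrite sumr_ge0.
exists s^-1; rewrite ?invr_gt0 // => r y.
have gs : g r y <= s.
  rewrite /s (bigD1 r) //= (bigD1 y) //= addrCA -addrA lerDl.
  by rewrite !addr_ge0 ?ler01 // sumr_ge0 // => i _; rewrite ?sumr_ge0.
rewrite ler_pdivrMl // -ler_pdivrMr // subr_gt0.
exact: lu.
Qed.

End BoundingFamily.

(** * The stacked trees on the grid *)

Section GridDigits.
Variables (n d : nat) (T : 'I_d -> bst).
Hypothesis Tbst : forall r, bst_on n (T r).

(* Level [r * n + k] is depth [k] of the tree of coordinate [r]. *)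
Definition grid_digit (x : gpoint n d) (i : nat) : 'I_3 :=
  if insub (i %/ n)%N is Some r then tree_digit (T r) (i %% n)%N (x r)
  else @Ordinal 3 1 isT.

Lemma grid_digitE (x : gpoint n d) (r : 'I_d) (k : nat) : (k < n)%N ->
  grid_digit x (r * n + k)%N = tree_digit (T r) k (x r).
Proof.
move=> kn; have n0 : (0 < n)%N by case: (n) kn.
rewrite /grid_digit divnMDl // (divn_small kn) addn0 valK.
by rewrite modnMDl modn_small.
Qed.

Lemma grid_level_lt (r : 'I_d) (k : nat) : (k < n)%N -> (r * n + k < d * n)%N.
Proof.
by move=> kn; have := ltn_ord r; nia.
Qed.

Lemma grid_digit_line (x : gpoint n d) (r : 'I_d) (v w : 'I_n) (k : nat) :
  (k < n)%N ->
  (forall i, (i < k)%N -> tree_digit (T r) i v = tree_digit (T r) i w) ->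
  forall i, (i < r * n + k)%N ->
    grid_digit (set_coord x r v) i = grid_digit (set_coord x r w) i.
Proof.
move=> kn eqd i ik; rewrite /grid_digit; case: insubP => // s _ sE.
rewrite !set_coordE; case: eqP => // sr; rewrite sr; apply: eqd.
by move: ik; rewrite {1}(divn_eq i n) -sE sr ltn_add2l.
Qed.

Lemma key_in_tree (r : 'I_d) (v : 'I_n) : nat_of_ord v \in keys (T r).
Proof. by have /andP[_ /perm_mem ->] := Tbst r; rewrite mem_iota /=. Qed.

Lemma sum_tree_keys (A : nmodType) (r : 'I_d) (F : nat -> A) :
  \sum_(v <- keys (T r)) F v = \sum_(v < n) F v.
Proof.
have /andP[_ kp] := Tbst r; rewrite (perm_big _ kp) /=.
by rewrite -{1}[n]subn0 -/(index_iota 0 n) big_mkord.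
Qed.

Lemma size_tree_keys (r : 'I_d) : size (keys (T r)) = n.
Proof. by have /andP[_ /perm_size ->] := Tbst r; rewrite size_iota. Qed.

Variable M : nat.
Variable c : {ffun {ffun 'I_(d * n) -> option 'I_3} -> 'I_M}.

(** Along a line in direction [r] the digits first differ where the two keys part in [T r], and
    there they are in the order of the keys. *)
Lemma unflipped_mono (x : gpoint n d) (r : 'I_d) (v w : 'I_n) : (v < w)%N ->
  (offset_val grid_digit c pred0 (set_coord x r v) <=
   offset_val grid_digit c pred0 (set_coord x r w))%N.
Proof.
move=> vw; have /andP[bt _] := Tbst r.
have [k [kn eqk ltk]] := first_tree_digit bt (key_in_tree r v) (key_in_tree r
  w) vw.
rewrite size_tree_keys in kn.
apply: ltnW; apply: (@offset_val_lt _ _ _ _ _ _ _ _ (r * n + k)).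
- exact: grid_level_lt.
- exact: grid_digit_line.
- by rewrite /= !grid_digitE // !set_coordE eqxx.
Qed.

Lemma flipped_violation (S : pred nat) (x : gpoint n d) (r : 'I_d)
    (v w : 'I_n) (k : nat) : (k < n)%N -> S (r * n + k)%N ->
  (forall i, (i < k)%N -> tree_digit (T r) i v = tree_digit (T r) i w) ->
  (tree_digit (T r) k v < tree_digit (T r) k w)%N ->
  (offset_val grid_digit c S (set_coord x r w) <
   offset_val grid_digit c S (set_coord x r v))%N.
Proof.
move=> kn Sk eqk ltk; apply: (@offset_val_lt _ _ _ _ _ _ _ _ (r * n + k)).
- exact: grid_level_lt.
- by move=> i ik; apply/esym/(grid_digit_line _ kn eqk).
- by rewrite Sk !grid_digitE // !set_coordE eqxx.
Qed.

End GridDigits.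

(** * From decision trees to randomized testers *)

Lemma card_not_roomy (L : nat) : exists M, (0 < M)%N /\
  (12 * #|[set c : {ffun {ffun 'I_L -> option 'I_3} -> 'I_M} | ~~ roomy c]| <=
   #|{: {ffun {ffun 'I_L -> option 'I_3} -> 'I_M}}|)%N.
Proof.
set T : finType := ({ffun 'I_L -> option 'I_3} : finType).
have [E cardT] : {E | #|{: T}| = E} by eexists.
(* With [E] nodes, [M - 4 = 48 * E] roomy values each, the fraction of offsets that are not roomy is
   at most 4E/M <= 1/12. *)
have [M ME] : {M | M = (48 * E + 4)%N} by eexists.
exists M; split; first by rewrite ME addnS.
have lt (v : 'I_(48 * E)) : (v + 2 < M)%N.
  by have := ltn_ord v; lia.
pose h (g : {ffun T -> 'I_(48 * E)}) : {ffun T -> 'I_M} :=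
  [ffun p => Ordinal (lt (g p))].
have hinj : injective h.
  move=> g1 g2 /ffunP e; apply/ffunP => p; have := e p; rewrite !ffunE.
  by move=> /(congr1 val) /= /addIn; exact: val_inj.
have cardh : #|[set h g | g in {: {ffun T -> 'I_(48 * E)}}]| = ((48 * E) ^ E)%N.
  by rewrite card_imset // card_ffun card_ord cardT.
have sub : [set h g | g in {: {ffun T -> 'I_(48 * E)}}] \subset
    ~: [set c : {ffun T -> 'I_M} | ~~ roomy c].
  apply/fintype.subsetP => _ /imsetP[g _ ->]; rewrite !inE negbK.
  by apply/forallP => p; rewrite ffunE /=;
    move: (nat_of_ord (g p)) (ltn_ord (g p)); lia.
have := subset_leq_card sub; rewrite cardh cardsCs finset.setCK card_ffun
  card_ord cardT.
(* Bernoulli's inequality (1 - 4/M)^k >= 1 - 4k/M, cleared of denominators and with truncated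
   subtraction. *)
have bernoulli k : (M ^ k * (M - 4 * k) <= (48 * E) ^ k * M)%N.
  elim: k => [|k IH]; first by rewrite !expn0 muln0 subn0.
  have step : (M * (M - 4 * k.+1) <= (48 * E) * (M - 4 * k))%N.
    have -> : (M - 4 * k.+1 = M - 4 * k - 4)%N by rewrite mulnS addnC subnDA.
    have : (M - 4 * k <= M)%N by lia.
    have -> : (48 * E = M - 4)%N by rewrite ME addnK.
    have : (4 <= M)%N by rewrite ME leq_addl.
    move: (M - 4 * k)%N => D M4 DM.
    by case: (leqP D 4) => D4; [rewrite (eqP D4) muln0|nia].
  rewrite [(M ^ _)%N]expnSr -mulnA; apply: leq_trans (leq_mul (leqnn _) step) _.
  move: IH; rewrite expnS; move: (48 * E)%N (M ^ k)%N (M - 4 * k)%N => B X Y IH.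
  by rewrite mulnCA -mulnA leq_mul2l IH orbT.
have := bernoulli E.
have -> : (M - 4 * E = 44 * E + 4)%N by lia.
move=> Bn; set bad := #|_|; set X := (M ^ E)%N in Bn *.
set Y := ((48 * E) ^ E)%N in Bn *.
have badX : (bad <= X)%N.
  by apply: leq_trans (max_card _) _; rewrite card_ffun card_ord cardT.
move: X Y bad Bn badX => X Y bad Bn badX; rewrite leq_subRL // => YX.
have M0 : (0 < M)%N by rewrite ME addnS.
have : (bad * M <= X * (4 * E))%N by rewrite ME in Bn *; nia.
rewrite -(leq_pmul2r M0) {2}ME => bM.
by nia.
Qed.

Section Probability.
Variables (R : realType) (dO : measure_display) (Omega : measurableType dO).
Variable P : probability Omega R.

Lemma prob_fineK (A : set Omega) : measurable A -> ((fine (P A))%:E = P A)%E.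
Proof. by move=> mA; rewrite fineK // fin_num_measure. Qed.

(** Expectation over the seed of a counting inequality that holds for each deterministic tree. *)
Lemma sum_prob_le (I : Type) (A B : I -> Omega -> bool) (s : seq I) (N : nat) :
  (forall i, measurable [set w | A i w]%classic) ->
  (forall i, measurable [set w | B i w]%classic) ->
  (forall w, (\sum_(i <- s) A i w <= \sum_(i <- s) B i w + N)%N) ->
  \sum_(i <- s) fine (P [set w | A i w]%classic) <=
    \sum_(i <- s) fine (P [set w | B i w]%classic) + N%:R.
Proof.
move=> mA mB AB.
have int (C : I -> Omega -> bool) :
  (forall i, measurable [set w | C i w]%classic) ->
  (\int[P]_w (\sum_(i <- s) (\1_[set w | C i w]%classic w)%:E)
   = (\sum_(i <- s) fine (P [set w | C i w]%classic))%:E)%E.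
  move=> mC; rewrite ge0_integral_sum //.
  - rewrite -sumEFin; apply: eq_bigr => i _.
    by rewrite integral_indic // setIT prob_fineK.
  - by move=> i; apply/measurable_EFinP; exact: measurable_indic.
have mint (C : I -> Omega -> bool) :
  (forall i, measurable [set w | C i w]%classic) ->
  measurable_fun setT
    (fun w => (\sum_(i <- s) (\1_[set w | C i w]%classic w : R)%:E)%E).
  move=> mC; apply: emeasurable_sum => i.
  by apply/measurable_EFinP; exact: measurable_indic.
have sumE (C : I -> Omega -> bool) w :
  ((\sum_(i <- s) (\1_[set w | C i w]%classic w)%:E) =
   (\sum_(i <- s) C i w)%N%:R%:E :> \bar R)%E.
  rewrite sumEFin natr_sum; congr (_%:E); apply: eq_bigr => i _.
  rewrite indicE; congr (nat_of_bool _)%:R.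
  by apply/idP/idP; rewrite inE.
rewrite -lee_fin EFinD -!int //.
have -> : ((N%:R : R)%:E = \int[P]_w (cst ((N%:R : R)%:E) w))%E.
  rewrite integral_cst // -[LHS]mule1; congr (_ * _)%E.
  exact/esym/(probability_setT P).
rewrite -ge0_integralD //.
- apply: ge0_le_integral => //.
  + by move=> w _; rewrite sumE lee_fin.
  + exact: mint.
  + by apply: emeasurable_funD => //; exact: mint.
  + by move=> w _; rewrite !sumE /= -EFinD lee_fin -natrD ler_nat.
- by move=> w _; rewrite sumE lee_fin.
- exact: mint.
- by move=> w _; rewrite lee_fin.
Qed.

Lemma prob_compl_lt (A : Omega -> bool) : measurable [set w | A w]%classic ->
  ((2 / 3)%:E < P [set w | ~~ A w]%classic)%E ->
  fine (P [set w | A w]%classic) <= 1 / 3.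
Proof.
move=> mA; have -> : [set w | ~~ A w]%classic = (~` [set w | A w])%classic.
  by apply/seteqP; split=> w /= /negP.
rewrite probability_setC // -(prob_fineK mA) -EFinB lte_fin; lra.
Qed.

(** Averages over seeds, offsets and swaps: acceptance of the unswapped functions and rejection of
    the swapped ones differ by at least a third, while [flip_indistinguishable_sum] limits the total
    difference. *)
Lemma hidden_offset_lower_bound (X : finType) (L : nat) (b : X -> nat -> 'I_3)
    (M : nat) (Phi : X -> nat -> R) (alg : Omega -> qtree R X) (q : nat)
    (I : eqType) (col : nat -> I) (js : seq I) :
  (0 < M)%N ->
  (12 * #|[set c : {ffun {ffun 'I_L -> option 'I_3} -> 'I_M} | ~~ roomy c]| <=
   #|{: {ffun {ffun 'I_L -> option 'I_3} -> 'I_M}}|)%N ->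
  uniq js -> (forall w, depth_le q (alg w)) ->
  (forall f, measurable [set w | run (alg w) f]%classic) ->
  (forall c : {ffun {ffun 'I_L -> option 'I_3} -> 'I_M},
    ((2 / 3)%:E <
      P [set w | run (alg w) (offset_fun b Phi pred0 c)]%classic)%E) ->
  (forall i (c : {ffun {ffun 'I_L -> option 'I_3} -> 'I_M}), i \in js ->
    ((2 / 3)%:E <
      P [set w | ~~ run (alg w)
                      (offset_fun b Phi (fun j => col j == i) c)]%classic)%E) ->
  (size js <= 4 * q)%N.
Proof.
move=> M0 bad ujs dq mrun acc rej.
set U : finType := ({ffun {ffun 'I_L -> option 'I_3} -> 'I_M} :
  finType) in bad acc rej *.
set bd := #|[set c : U | _]| in bad.
have U0 : (0 < #|{: U}|)%N by rewrite card_ffun card_ord expn_gt0 M0.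
pose s := [seq (i, c) | i <- js, c <- enum U].
pose A (u : I * U) w := run (alg w) (offset_fun b Phi pred0 u.2).
pose B (u : I * U) w :=
  run (alg w) (offset_fun b Phi (fun j => col j == u.1) u.2).
have size_s : size s = (size js * #|{: U}|)%N by rewrite size_allpairs -cardE.
have := @sum_prob_le _ A B s (q * #|{: U}| + size js * bd)%N.
have mA u : measurable [set w | A u w]%classic by exact: mrun.
have mB u : measurable [set w | B u w]%classic by exact: mrun.
move=> /(_ mA mB).
have count (w : Omega) :
    (\sum_(u <- s) A u w <=
     \sum_(u <- s) B u w + (q * #|{: U}| + size js * bd))%N.
  have := @flip_indistinguishable_sum X L b M R Phi (alg w) I col js q ujs
    (dq w).
  rewrite !big_allpairs; congr (_ <= _ + _)%N; apply: eq_bigr => i _.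
    rewrite -sum1dep_card [LHS]big_mkcond big_enum; exact: eq_big.
  rewrite -sum1dep_card [LHS]big_mkcond big_enum; exact: eq_big.
move=> /(_ count) le_sum.
have lowA : (size s)%:R * (2 / 3) <=
    \sum_(u <- s) fine (P [set w | A u w]%classic).
  rewrite mulr_natl -[X in _ *+ X]sum1_size -sumrMnr big_seq [leRHS]big_seq.
  apply: ler_sum => u _; rewrite mulr1n -lee_fin (prob_fineK (mA u)).
  exact: (ltW (acc u.2)).
have upB : \sum_(u <- s) fine (P [set w | B u w]%classic) <=
    (size s)%:R * (1 / 3).
  rewrite [leRHS]mulr_natl -[X in _ *+ X]sum1_size -sumrMnr big_seq
    [leRHS]big_seq.
  apply: ler_sum => u /allpairsP[[i c] /= [ijs _ ->]]; rewrite mulr1n.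
  by apply: prob_compl_lt => //; exact: rej.
have le3 : (size s <= 3 * (q * #|{: U}| + size js * bd))%N.
  by rewrite -(ler_nat R) natrM; lra.
rewrite size_s in le3; rewrite -(leq_pmul2r U0).
(* With K swaps, V offset families and e of them not roomy, the bound reads KV/3 <= qV + Ke; as e <=
   V/12, this leaves K/4 <= q. *)
have arith (K e V : nat) : (K * V <= 3 * (q * V + K * e))%N ->
  (K * (12 * e) <= K * V)%N -> (K * V <= 4 * q * V)%N by nia.
exact: arith le3 (leq_mul (leqnn _) bad).
Qed.

End Probability.

(** * Bundles of far swaps *)

(** Colour [K] is the block still open. It is closed once its mass reaches 1, and since it was below
    1 and the last item weighs at most 1, a closed block has mass below 2. *)
Lemma greedy_blocks (R : realFieldType) (I : eqType) (s : seq I) (m : I -> R) :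
  uniq s -> (forall i, 0 <= m i <= 1) ->
  exists K (col : I -> nat), [/\
    forall j, (j < K)%N -> 1 <= \sum_(i <- s | col i == j) m i,
    \sum_(i <- s | col i == K) m i < 1,
    forall i, i \in s -> (col i <= K)%N &
    \sum_(i <- s) m i <= (2 * K)%:R + \sum_(i <- s | col i == K) m i].
Proof.
move=> + m01; elim: s => [_|x s IH /= /andP[xs us]].
  by exists 0%N, (fun=> 0%N); split => //; rewrite !big_nil ?ltr01 ?addr0.
have [K [col [big_lt last_lt col_le tot]]] := IH us.
pose col' i := if i == x then K else col i.
have sum_col j : \sum_(i <- x :: s | col' i == j) m i =
    (if K == j then m x else 0) + \sum_(i <- s | col i == j) m i.
  rewrite big_cons /col' eqxx.
  have -> : \sum_(i <- s | (if i == x then K else col i) == j) m i =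
      \sum_(i <- s | col i == j) m i.
    rewrite big_seq_cond [RHS]big_seq_cond; apply: eq_bigl => i.
    by have [->|//] := eqVneq i x; rewrite (negbTE xs).
  by case: eqP; rewrite ?add0r.
have /andP[mx0 mx1] := m01 x.
have sum_ge0 j : 0 <= \sum_(i <- s | col i == j) m i.
  by apply: sumr_ge0 => i _; have /andP[] := m01 i.
have [lt1|ge1] := ltP (m x + \sum_(i <- s | col i == K) m i) 1.
  exists K, col'; split.
  - move=> j jK; rewrite sum_col (gtn_eqF jK) add0r; exact: big_lt.
  - by rewrite sum_col eqxx.
  - move=> i; rewrite in_cons /col'; case: eqP => //= _; exact: col_le.
  - by rewrite sum_col eqxx big_cons; lra.
have last0 : \sum_(i <- s | col i == K.+1) m i = 0.
  rewrite big_seq_cond big1 // => i /andP[/col_le iK /eqP e].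
  by move: iK; rewrite e ltnn.
exists K.+1, col'; split.
- move=> j; rewrite ltnS leq_eqVlt sum_col => /predU1P[->|jK].
    by rewrite eqxx.
  by rewrite (gtn_eqF jK) add0r; exact: big_lt.
- by rewrite sum_col (ltn_eqF (ltnSn K)) last0 addr0 ltr01.
- move=> i; rewrite in_cons /col'; case: eqP => //= _ iK.
  exact: leqW (col_le _ iK).
- rewrite sum_col (ltn_eqF (ltnSn K)) last0 !addr0 big_cons.
  by rewrite mulnS natrD; lra.
Qed.

Lemma disjoint_bundles (R : realFieldType) (I : finType) (m : I -> R)
    (theta : R) : (forall i, 0 <= m i <= 1) -> theta <= 1 ->
  theta < \sum_i m i ->
  exists u : nat * (I -> nat),
    (forall j, (j < u.1)%N -> theta <= \sum_(i | u.2 i == j) m i) /\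
    \sum_i m i <= (3 * u.1)%:R.
Proof.
move=> m01 theta1 ltm.
have [K [col [big_lt last_lt _ tot]]] :=
  greedy_blocks (index_enum_uniq I) m01.
(* If no block was closed, the total is below 1 and everything forms one bundle, of mass above
   [theta]. Otherwise the open rest is below 1, and 2K + 1 <= 3K. *)
case: K => [|K] in big_lt last_lt tot *.
  exists (1%N, fun=> 0%N); split => [[|//] _|] /=; first exact: ltW.
  by rewrite muln0 add0r in tot; rewrite muln1; lra.
exists (K.+1, col); split => [j jK|] /=.
  by apply: le_trans theta1 _; exact: big_lt.
rewrite (_ : 3 * K.+1 = 2 * K.+1 + K.+1)%N; last by lia.
have : 1 <= K.+1%:R :> R by rewrite ler1n.
by rewrite natrD; lra.
Qed.

(** * Level masses, truncation and distance of swapped functions *)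

Section MedianTrees.
Variables (R : realType) (n d : nat) (D : 'I_d -> 'I_n -> R).
Hypothesis prodD : is_prod_dist D.

Definition extend_dist (p : 'I_n -> R) (v : nat) : R :=
  if insub v is Some y then p y else 0.

Lemma extend_distE (p : 'I_n -> R) (v : 'I_n) : extend_dist p v = p v.
Proof. by rewrite /extend_dist valK. Qed.

Lemma extend_dist_ge0 (r : 'I_d) (v : nat) : 0 <= extend_dist (D r) v.
Proof.
by rewrite /extend_dist; case: insubP => // y _ _; have [] := prodD r.
Qed.

Lemma median_trees : exists T : 'I_d -> bst, forall r,
  bst_on n (T r) /\ balanced (extend_dist (D r)) (T r).
Proof.
have ex r : exists t, bst_on n t /\ balanced (extend_dist (D r)) t.
  have [t [bt kt ht]] := balanced_bst_exists (extend_dist_ge0 r) 0 n.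
  by exists t; split => //; rewrite /bst_on bt kt perm_refl.
have [T TP] := choice ex.
by exists T.
Qed.

Variable T : 'I_d -> bst.
Hypothesis Tbst : forall r, bst_on n (T r).

Definition level_mass (k : nat) (r : 'I_d) : R :=
  deep_mass (extend_dist (D r)) (T r) k.+1.

Lemma level_massE (k : nat) (r : 'I_d) :
  level_mass k r = \sum_v D r v * (k < depth (T r) v)%:R.
Proof.
rewrite /level_mass /deep_mass (sum_tree_keys Tbst).
by apply: eq_bigr => v _; rewrite extend_distE.
Qed.

Lemma level_mass01 (k : nat) (r : 'I_d) : 0 <= level_mass k r <= 1.
Proof.
have [D0 D1] := prodD r; rewrite level_massE; apply/andP; split.
  by apply: sumr_ge0 => v _; rewrite mulr_ge0.
rewrite -[leRHS]D1; apply: ler_sum => v _.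
by rewrite ler_piMr // lern1 leq_b1.
Qed.

Lemma level_mass_size (r : 'I_d) : level_mass n r = 0.
Proof.
rewrite level_massE big1 // => v _.
have := depth_le_size (T r) v; rewrite (size_tree_keys Tbst) leqNgt.
by move=> /negbTE ->; rewrite mulr0.
Qed.

Lemma sum_ltn_ord (tau a : nat) : (\sum_(k < tau) (k < a) = minn a tau)%N.
Proof.
elim: tau => [|tau IH]; first by rewrite big_ord0 minn0.
by rewrite big_ord_recr /= IH; case: (ltnP tau a); lia.
Qed.

(** All keys deeper than [tau] move to the root of their tree. The cost in total variation is a
    union bound over coordinates, and the tree [T r] itself witnesses the small optimal depth. *)
Lemma truncated_dist (tau : nat) : exists D' : 'I_d -> 'I_n -> R, [/\
  is_prod_dist D', tv D D' <= 1, tv D D' <= \sum_r level_mass tau r &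
  delta_star D' <= \sum_(k < tau) \sum_r level_mass k r].
Proof.
pose phi r (v : 'I_n) := if (depth (T r) v <= tau)%N then v
  else odflt v [pick w : 'I_n | depth (T r) w == 0%N].
have root r (v : 'I_n) : exists w : 'I_n, depth (T r) w = 0%N.
  have vT := key_in_tree Tbst r v.
  case E : (T r) vT => [//|lt k rt] _.
  have kT : k \in keys (T r) by rewrite E /= mem_cat mem_head orbT.
  have /andP[_ /perm_mem kp] := Tbst r.
  move: kT; rewrite kp mem_iota /= add0n => kn.
  by exists (Ordinal kn); rewrite /= eqxx.
have depth_phi r v : depth (T r) (phi r v) =
    if (depth (T r) v <= tau)%N then depth (T r) v else 0%N.
  rewrite /phi; case: ifP => // _; case: pickP => [w /eqP //|none].
  by have [w /eqP] := root r v; rewrite none.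
exists (push_dist D phi); split.
- exact: push_dist_prod.
- exact: tv_push_le1.
- apply: le_trans (tv_push_le_sum prodD phi) _.
  apply: ler_sum => r _; rewrite level_massE; have [D0 _] := prodD r.
  apply: ler_sum => v _; rewrite ler_wpM2l // ler_nat /phi.
  by case: (leqP (depth (T r) v) tau); rewrite ?eqxx // leq_b1.
- rewrite exchange_big /=; apply: ler_sum => r _.
  have [D0 _] := prodD r.
  apply: (@le_trans _ _ (exp_depth (push_dist D phi r) (T r))).
    apply: ge_inf; last by exists (T r) => //; exact: Tbst.
    exists 0 => _ [t _ <-]; apply: sumr_ge0 => v _.
    by rewrite mulr_ge0 //; have [] := push_dist_prod prodD phi r.
  rewrite /exp_depth (sum_push_dist D phi r (fun v => (depth (T r) v)%:R)).
  under [leRHS]eq_bigr do rewrite level_massE.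
  rewrite exchange_big /=; apply: ler_sum => v _; rewrite -big_distrr /=.
  (* Layer-cake formula: the indicators of [k < depth] over [k < tau] add up to the depth capped at
     [tau], which is at least the depth after the move. *)
  rewrite ler_wpM2l // -natr_sum ler_nat depth_phi sum_ltn_ord.
  by case: (leqP (depth (T r) v) tau).
Qed.

Hypothesis Tbal : forall r, balanced (extend_dist (D r)) (T r).
Variables (l u : 'I_d -> 'I_n.-1 -> R) (delta : R) (M : nat).
Hypothesis delta_gt0 : 0 < delta.

(** On each line in a direction of [A], the agreement set with [h] is level-independent, so
    [level_weights] bounds the disagreement there; the second moment combines the directions. *)
Lemma flipped_far (S : pred nat) (A : pred 'I_d) (k : nat)
    (c : {ffun {ffun 'I_(d * n) -> option 'I_3} -> 'I_M})
    (h : gpoint n d -> R) : (k < n)%N ->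
  (forall r, A r -> S (r * n + k)%N) -> in_PB l u h ->
  (\sum_(r | A r) level_mass k r) / (8 + 16 * \sum_(r | A r) level_mass k r)
    <= distD D (offset_fun (grid_digit T) (perturbed u delta) S c) h.
Proof.
move=> kn AS hP; set F := offset_fun _ _ S c.
have exw r := level_weights (extend_dist_ge0 r) k
  (andP (Tbst r)).1 (Tbal r).
have [w wP] := choice exw.
apply: (second_moment_bound prodD (A := A) (w := fun r v => w r v)
  (m := level_mass k) (Z := fun x => F x != h x)).
- by move=> r; have /andP[] := level_mass01 k r.
- by move=> r v; have [] := wP r.
- move=> r; have [_ + _] := wP r; rewrite (sum_tree_keys Tbst).
  by under eq_bigr do rewrite extend_distE.
move=> r x Ar.
pose W (v : nat) := if insub v is Some v' then
  F (set_coord x r v') == h (set_coord x r v') else false.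
have [_ _ /(_ W)] := wP r.
rewrite (sum_tree_keys Tbst).
under eq_bigr do rewrite extend_distE /W valK -mulrA.
apply=> v v' vT vT' Wv Wv' vv' eqd ltd.
move: Wv Wv'; rewrite /W; case: insubP => // y _ yE /eqP Fy.
case: insubP => // y' _ yE' /eqP Fy'.
rewrite -yE -yE' in vv' eqd ltd.
apply: (perturbed_violation (val := offset_val (grid_digit T) c S) delta_gt0
  hP vv' _ Fy Fy').
exact: (flipped_violation c x kn (AS r Ar) eqd ltd).
Qed.

End MedianTrees.

(** * The query lower bound *)

Lemma tester_query_bound (R : realType) (n d : nat)
    (l u : 'I_d -> 'I_n.-1 -> R) (D : 'I_d -> 'I_n -> R) (eps : R)
    (T : 'I_d -> bst) (dO : measure_display) (Omega : measurableType dO)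
    (P : probability Omega R) (alg : Omega -> qtree R (gpoint n d)) (q : nat)
    (tau : nat) (B : nat -> nat * ('I_d -> nat)) :
  bounding_family l u -> is_prod_dist D ->
  (forall r, bst_on n (T r)) ->
  (forall r, balanced (extend_dist (D r)) (T r)) ->
  is_tester P alg q (in_PB l u) D eps ->
  (tau <= n)%N -> 0 < eps -> 25 * eps <= 1 ->
  (forall k j, (k < tau)%N -> (j < (B k).1)%N ->
    25 * eps <= \sum_(r | (B k).2 r == j) level_mass D T k r) ->
  (\sum_(k < tau) (B k).1 <= 4 * q)%N.
Proof.
move=> lu prodD Tbst Tbal [dq mrun acc rej] taun eps0 eps1 Bmass.
have [M [M0 bad]] := card_not_roomy (d * n).
have [delta delta0 dV] := perturbation_scale ((M + 2) ^ (d * n)) lu.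
pose js := [seq (k, j) | k <- iota 0 tau, j <- iota 0 (B k).1].
(* A swap is a pair of a depth [k] and a bundle [j] at that depth; a grid level belongs to the
   bundle of its direction [i %/ n]. The default 0 concerns only levels from [d * n] on. *)
pose col i := (i %% n, oapp (B (i %% n)).2 0 (insub (i %/ n)))%N.
have colE (r : 'I_d) k : (k < n)%N -> col (r * n + k)%N = (k, (B k).2 r).
  move=> kn; have n0 : (0 < n)%N by exact: leq_ltn_trans kn.
  by rewrite /col divnMDl // (divn_small kn) addn0 valK modnMDl modn_small.
have size_js : size js = (\sum_(k < tau) (B k).1)%N.
  rewrite size_allpairs_dep sumnE big_map -{1}[tau]subn0 -/(index_iota 0 tau).
  by rewrite big_mkord; apply: eq_bigr => k _; rewrite size_iota.
have ujs : uniq js.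
  apply: allpairs_uniq_dep; first exact: iota_uniq.
    by move=> k _; exact: iota_uniq.
  by move=> [k j] [k' j'] _ _ /= [-> ->].
have in_P c : in_PB l u (offset_fun (grid_digit T) (perturbed u delta) pred0
    (c : {ffun {ffun 'I_(d * n) -> option 'I_3} -> 'I_M})).
  apply: (perturbed_in_PB delta0 dV) => [x|x r v w vw].
    exact: offset_val_ltX.
  exact: unflipped_mono.
rewrite -size_js.
apply: (@hidden_offset_lower_bound _ _ _ P _ (d * n) (grid_digit T) M
  (perturbed u delta) alg q _ col js M0 bad ujs dq mrun) => [c|].
  exact: acc.
move=> i c /allpairsPdep[k [j [+ + ->]]]; rewrite !mem_iota /= !add0n => kt jB.
apply: rej; set F := offset_fun _ _ _ c.
have kn : (k < n)%N by exact: leq_trans kt taun.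
set mu := \sum_(r | (B k).2 r == j) level_mass D T k r.
have mu_ge : 25 * eps <= mu by exact: Bmass.
(* Source of the constant 25: [mu >= 25 * eps] and [25 * eps <= 1] give mu (1 - 16 eps) >= 9 eps > 8
   eps. *)
apply: (@lt_le_trans _ _ (mu / (8 + 16 * mu))).
  by rewrite ltr_pdivlMr; nra.
apply: lb_le_inf.
  by eexists; exists (offset_fun (grid_digit T) (perturbed u delta) pred0 c).
move=> _ [g gP <-].
apply: (flipped_far prodD Tbst Tbal delta0 (A := fun r =>
  (B k).2 r == j) c kn _ gP).
by move=> r /eqP rj; rewrite colE // rj eqxx.
Qed.

Theorem theorem1p6 (R : realType) :
  exists c1 c2 c : R, [/\ 0 < c1, 0 < c2, 0 < c &
  forall eps : R, 0 < eps ->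
  exists eps' : R, c1 * eps <= eps' <= c2 * eps /\
  forall (n d : nat) (l u : 'I_d -> 'I_n.-1 -> R) (rho : R)
         (D : 'I_d -> 'I_n -> R),
    bounding_family l u -> is_prod_dist D -> stable eps' rho D ->
    forall (dO : measure_display) (Omega : measurableType dO)
           (P : probability Omega R) (alg : Omega -> qtree R (gpoint n d))
           (q : nat),
      is_tester P alg q (in_PB l u) D eps ->
      c * rho * delta_star D <= q%:R].
Proof.
(* The factor 12 is 3 from the bundling times 4 from the averaging over offsets. *)
exists 25, 25, 12^-1; split; rewrite ?invr_gt0 //.
move=> eps eps0; exists (25 * eps); rewrite lexx; split=> //.
move=> n d l u rho D lu prodD stableD dO Omega P alg q tester.
suff : rho * delta_star D <= (12 * q)%:R by rewrite natrM; lra.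
have [T TP] := median_trees prodD.
have Tbst r := (TP r).1; have Tbal r := (TP r).2.
(* For [25 * eps >= 1] stability reaches a distribution concentrated on the roots, whose optimal
   depth is 0, so the bound is trivial. *)
have [ge1|lt1] := leP 1 (25 * eps).
  have [D' [prodD' tv1 _ delta0]] := truncated_dist prodD Tbst 0.
  apply: le_trans (stableD D' prodD' (le_trans tv1 ge1)) _.
  by apply: le_trans delta0 _; rewrite big_ord0.
(* The first depth [tau] below which little enough mass is left to be moved within [eps']; at every
   smaller depth the mass exceeds [25 * eps], so far bundles exist. *)
have ex_tau : exists k, \sum_r level_mass D T k r <= 25 * eps.
  exists n; rewrite big1 => [|r _]; last exact: level_mass_size.
  by rewrite mulr_ge0 ?ltW.
have [tau tau_le tau_min] := ex_minnP ex_tau.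
have taun : (tau <= n)%N.
  apply: tau_min; rewrite big1 => [|r _]; last exact: level_mass_size.
  by rewrite mulr_ge0 ?ltW.
have exB k : exists U : nat * ('I_d -> nat), (k < tau)%N ->
    (forall j, (j < U.1)%N ->
      25 * eps <= \sum_(r | U.2 r == j) level_mass D T k r) /\
    \sum_r level_mass D T k r <= (3 * U.1)%:R.
  have [kt|tk] := ltnP k tau; last by exists (0%N, fun=> 0%N).
  have [|U HU] := disjoint_bundles (level_mass01 prodD Tbst k) (ltW lt1).
    by rewrite ltNge; apply/negP => /tau_min; rewrite leqNgt kt.
  by exists U.
have [B BP] := choice exB.
have Bmass k j : (k < tau)%N -> (j < (B k).1)%N ->
    25 * eps <= \sum_(r | (B k).2 r == j) level_mass D T k r.
  by move=> kt; have [+ _] := BP k kt; exact.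
have := tester_query_bound lu prodD Tbst Tbal tester taun eps0 (ltW lt1) Bmass.
have [D' [prodD' _ tvD' deltaD']] := truncated_dist prodD Tbst tau.
move=> le4; apply: le_trans (stableD D' prodD' (le_trans tvD' tau_le)) _.
apply: le_trans deltaD' _.
apply: (@le_trans _ _ (\sum_(k < tau) (3 * (B k).1)%:R)).
  by apply: ler_sum => k _; have [_] := BP k (ltn_ord k).
rewrite -natr_sum ler_nat -big_distrr /= (_ : 12 * q = 3 * (4 * q))%N.
  by rewrite leq_mul2l.
by rewrite mulnA.
Qed.
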